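(* Suppose there exists $C>0$ such that $\tau(m)\leq C\log_2 m$ for all $m\in\mathbb{Z}^+$. Then $$\lim_{x\to\infty}\frac{1}{x\log_2 x}\sum_{m=1}^{\lfloor x\rfloor}\tau(m)= \frac{1}{1-\log_2\sqrt{3}}.$$
   Context: The map $\mathsf{T}:\mathbb{Z}^+\to\mathbb{Z}^+$ on the positive integers is defined by $\mathsf{T}(m)=\frac{m}{2}$ if $m$ is even and $\mathsf{T}(m)=\frac{3m+1}{2}$ if $m$ is odd; $\mathsf{T}^n$ denotes its $n$-fold iterate ($\mathsf{T}^0$ is the identity). For $m\in\mathbb{Z}^+$, the total stopping time $\tau(m)\in\{0,1,2,\dots\}\cup\{\infty\}$ is the minimal integer $n\geq 0$ such that $\mathsf{T}^n(m)=1$ if such an $n$ exists, and $\tau(m)=\infty$ otherwise. Here $x$ ranges over the real numbers and $\lfloor x\rfloor$ is the greatest integer $\leq x$. *)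

(* Defs.v *)
From mathcomp Require Import all_boot all_order all_algebra.
From mathcomp Require Import all_classical all_reals all_analysis.

Set Implicit Arguments.
Unset Strict Implicit.
Unset Printing Implicit Defensive.

Import Order.TTheory GRing.Theory Num.Theory.
Import numFieldNormedType.Exports.

Local Open Scope ring_scope.

(* Defined on all of nat; it preserves the positive integers, and only its
   values there matter (collatzT 0 = 0 is never used). *)
Definition collatzT (m : nat) : nat :=
  if odd m then ((3 * m + 1)./2)%N else m./2.

(* [ex_minn h] is the least n with T^n(m) = 1, where h proves that one exists. *)
Definition total_stopping_time (R : realType) (m : nat) : \bar R :=
  if pselect (exists n, iter n collatzT m == 1%N) is left h
  then (ex_minn h)%:R%:E else +oo%E.

Definition log2 (R : realType) (x : R) : R := ln x / ln 2.

(* Main.v *)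
Require Import Defs.
From mathcomp Require Import all_boot all_order all_algebra.
From mathcomp Require Import all_classical all_reals all_analysis.
From mathcomp Require Import zify ring lra.

Import Order.TTheory GRing.Theory Num.Theory.
Import numFieldNormedType.Exports.

(** Put [L = log2 (sqrt 3)] and let [m] range over the integers below [2 ^ N].
    The parities of the first [N] iterates of [m] are exactly [N] independent
    fair coin tosses, an even step halves and an odd step multiplies by about
    3/2, so the [N]-th iterate is about [2 ^ (L N)] for all but
    [2 ^ ((1 - d) N)] values of [m], for some [d > 0]; such exceptional
    families are called sparse below.

    Those [N] steps use up all the randomness of [m], and the [N]-th iterates
    need not be equidistributed at their own scale [2 ^ M], [M ~ L N].  What
    makes a further round of [M] steps possible is that the preimage of a sparse
    family is sparse ([sparse_pullback]).  This is a counting statement: with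
    [l] slightly below [L N], a regular [m] is determined by its residue modulo
    [2 ^ (N - l)], its number [a] of odd steps and its [N]-th iterate
    ([regular_inj]), so that each point of scale [2 ^ M] has at most
    [2 ^ (N - l) (N + 1)] regular preimages, which up to a factor
    [2 ^ (small N)] is the average.  Indeed two
    integers with the same data reach, after [N - l] steps, values whose
    difference, multiplied by the slope of the remaining [l] steps, is a multiple
    of [3 ^ a]; it also equals the difference of two additive terms of the last
    [l] steps, which are less than [3 ^ a].

    After [j] rounds, all [m] outside a sparse family have, at a time close to
    [(1 + L + ... + L ^ (j - 1)) N], an iterate that is greater than 2 and at
    most about [2 ^ (L ^ j N)] ([atypical_sparse]).  An iterate greater than 2
    means that 1 has not been met before, and by the assumed logarithmic bound
    the remaining time is at most about [C L ^ j N].  As [j] grows, the total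
    stopping time is [N / (1 - L)] up to [e N], outside a sparse family whose
    contribution to the average is negligible, again by the logarithmic
    bound. *)

Section Combinatorics.
Local Open Scope nat_scope.

(** * Affine form of the iterates *)

Definition odds (n m : nat) : nat := \sum_(i < n) odd (iter i collatzT m).

(** The additive term of the affine map followed by [m] in [n] steps; see
    [iter_affine]. *)
Definition carry (n m : nat) : nat :=
  \sum_(i < n | odd (iter i collatzT m)) 3 ^ (odds n m - odds i.+1 m) * 2 ^ i.

Lemma odds0 m : odds 0 m = 0.
Proof. by rewrite /odds big_ord0. Qed.

Lemma oddsS n m : odds n.+1 m = odds n m + odd (iter n collatzT m).
Proof. by rewrite /odds big_ord_recr. Qed.

Lemma odds_add p l m : odds (p + l) m = odds p m + odds l (iter p collatzT m).
Proof.
elim: l => [|l IH]; first by rewrite addn0 odds0 addn0.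
by rewrite addnS !oddsS IH addnA -iterD (addnC l).
Qed.

Lemma odds_le n m : odds n m <= n.
Proof. by elim: n => [|n IH]; rewrite ?odds0 // oddsS; case: odd; lia. Qed.

Lemma leq_odds i n m : i <= n -> odds i m <= odds n m.
Proof. by move=> /subnKC <-; rewrite odds_add leq_addr. Qed.

Lemma collatzT_double2 x : 2 * collatzT x = if odd x then 3 * x + 1 else x.
Proof. by rewrite /collatzT; case: ifP => ox; lia. Qed.

Lemma collatzT_shift x w :
  collatzT (x + 2 * w) = collatzT x + (if odd x then 3 * w else w).
Proof. by rewrite /collatzT oddD oddM /= addbF; case: ifP => ox; lia. Qed.

Lemma carryS n m : carry n.+1 m =
  if odd (iter n collatzT m) then 3 * carry n m + 2 ^ n else carry n m.
Proof.
rewrite /carry big_mkcond big_ord_recr /= -big_mkcond /= oddsS.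
case: ifP => ox.
  rewrite ox addn1 subnn expn0 mul1n big_distrr /=; congr (_ + _).
  apply: eq_bigr => i _; rewrite mulnA -expnS; congr (3 ^ _ * _).
  by have := leq_odds _ _ m (ltn_ord i); lia.
by rewrite !addn0.
Qed.

Lemma iter_affine n m :
  2 ^ n * iter n collatzT m = 3 ^ odds n m * m + carry n m.
Proof.
elim: n => [|n IH]; first by rewrite odds0 /carry big_ord0 /=; lia.
rewrite oddsS expnD carryS iterS expnSr -mulnA collatzT_double2.
case: ifP => ox /=; last by rewrite IH expn0 muln1.
by rewrite mulnDr mulnCA IH expn1; lia.
Qed.

(** The first [n] parities depend only on the residue of [m] modulo [2 ^ n], and
    the slope [3 ^ odds n m] is odd, so digit [n] of [m] decides the next parity:
    this is what makes the parities of a uniform [m] independent. *)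
Lemma iter_shift n m u :
  odds n (m + 2 ^ n * u) = odds n m /\
  iter n collatzT (m + 2 ^ n * u) = iter n collatzT m + 3 ^ odds n m * u.
Proof.
elim: n u => [|n IH] u; first by rewrite !odds0 /=; lia.
have := IH (2 * u); rewrite mulnA -expnSr => -[IHo IHi].
rewrite !oddsS !iterS IHo IHi mulnCA collatzT_shift oddD oddM /= addbF.
by split=> //; case: ifP => ox /=; rewrite ?addn1 ?addn0 ?expnS; lia.
Qed.

Lemma odds_shift n p m u : n <= p -> odds n (m + 2 ^ p * u) = odds n m.
Proof.
move=> np; rewrite -(subnKC np) expnD -mulnA.
by have [] := iter_shift n m (2 ^ (p - n) * u).
Qed.

Lemma iter_collatzT_pos n m : 0 < m -> 0 < iter n collatzT m.
Proof.
move=> m0; elim: n => [//|n IH]; rewrite iterS.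
by have := collatzT_double2 (iter n collatzT m); case: odd; lia.
Qed.

Lemma iter_collatzT_1 n : iter n collatzT 1 <= 2.
Proof.
suff : iter n collatzT 1 = 1 \/ iter n collatzT 1 = 2 by case=> ->.
by elim: n => [|n [IH|IH]]; rewrite ?iterS ?IH /=; auto.
Qed.

(** * Regular parity sequences *)

Definition regular (h N m : nat) : bool :=
  [forall i : 'I_N.+1, (2 * odds i m <= i + h) && (i <= 2 * odds i m + h)].

Lemma regularP h N m i : regular h N m -> i <= N ->
  2 * odds i m <= i + h /\ i <= 2 * odds i m + h.
Proof.
move=> /forallP reg; rewrite -ltnS => iN.
by have /andP := reg (Ordinal iN).
Qed.

(** A step at time [i] contributes [3 ^ (odds after i) * 2 ^ i]; when at most
    about half of the later steps are odd, [3 ^ (1/2) <= 2] bounds it by about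
    [2 ^ (n - i) * 2 ^ i]. *)
Lemma carry_le n m h :
  (forall i, i <= n -> 2 * odds n m + i <= 2 * odds i m + n + 2 * h) ->
  carry n m <= n * 2 ^ (n + 2 * h).
Proof.
move=> H; rewrite /carry -[X in _ <= X * _](card_ord n) -sum_nat_const.
rewrite [X in X <= _]big_mkcond; apply: leq_sum => i _; case: ifP => // ox.
have := H i (ltnW (ltn_ord i)).
set a := odds n m - _ => Hi.
have {}Hi : 2 * a <= (n - i) + 2 * h by rewrite /a oddsS ox; have := ltn_ord i; lia.
have -> : n + 2 * h = (n - i) + 2 * h + i by have := ltn_ord i; lia.
rewrite expnD leq_mul2r; apply/orP; right.
rewrite -(@leq_exp2r _ _ 2) //.
rewrite -!expnM mulnC [in leqRHS]mulnC [in leqRHS]expnM.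
rewrite (leq_trans (leq_pexp2l _ Hi)) //.
by rewrite leq_exp2r //; have := ltn_ord i; lia.
Qed.

Lemma regular_suffix_carry h p l m : regular h (p + l) m ->
  carry l (iter p collatzT m) <= l * 2 ^ (l + 2 * h).
Proof.
move=> reg; apply: carry_le => i il.
have [_] := @regularP _ _ _ (p + i) reg ltac:(lia).
have [+ _] := @regularP _ _ _ (p + l) reg (leqnn _).
by rewrite !odds_add; lia.
Qed.

Lemma regular_odds_lower h N m : regular h N m ->
  3 ^ (N - h) <= (3 ^ odds N m) ^ 2.
Proof.
move=> reg; rewrite -expnM leq_pexp2l //.
by have := @regularP _ _ _ N reg (leqnn _); lia.
Qed.

Lemma regular_odds_upper h N m : regular h N m ->
  (3 ^ odds N m) ^ 2 <= 3 ^ (N + h).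
Proof.
move=> reg; rewrite -expnM leq_pexp2l //.
by have := @regularP _ _ _ N reg (leqnn _); lia.
Qed.

(** The absence of collisions behind the whole proof.  Writing
    [m = m0 + 2 ^ p u], the last [l] steps send
    [iter p collatzT m0 + 3 ^ odds p m0 * u] to the common end point with a common
    slope, so [3 ^ odds (p + l) m * (u - u')] is the difference of two carries,
    and both carries are smaller than that power of 3. *)
Lemma regular_inj h p l m m' :
  (l * 2 ^ (l + 2 * h)) ^ 2 < 3 ^ (p + l - h) ->
  regular h (p + l) m -> regular h (p + l) m' ->
  m %% 2 ^ p = m' %% 2 ^ p -> odds (p + l) m = odds (p + l) m' ->
  iter (p + l) collatzT m = iter (p + l) collatzT m' -> m = m'.
Proof.
move=> small reg reg' eqm eqo eqT.
have C := regular_suffix_carry _ _ _ _ reg.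
have C' := regular_suffix_carry _ _ _ _ reg'.
have big := leq_trans small (regular_odds_lower _ _ _ reg).
have {small} big : l * 2 ^ (l + 2 * h) < 3 ^ odds (p + l) m.
  by rewrite -(@ltn_exp2r _ _ 2).
have iterA x : iter (p + l) collatzT x = iter l collatzT (iter p collatzT x).
  by rewrite addnC iterD.
have A := iter_affine l (iter p collatzT m).
have A' := iter_affine l (iter p collatzT m').
move: eqo eqT big; rewrite !odds_add !iterA => eqo eqT.
have Em := divn_eq m (2 ^ p); have Em' := divn_eq m' (2 ^ p).
rewrite -eqm in Em'; rewrite addnC mulnC in Em; rewrite addnC mulnC in Em'.
move: (m %/ 2 ^ p) (m' %/ 2 ^ p) (m %% 2 ^ p) Em Em' => u u' m0 Em Em'.
have [q1 i1] := iter_shift p m0 u; have [q1' i1'] := iter_shift p m0 u'.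
rewrite -Em in q1 i1; rewrite -Em' in q1' i1'.
rewrite q1 q1' in eqo; move/addnI: eqo => eqb.
rewrite q1 [in ltnRHS]expnD => big.
rewrite -eqT -eqb A i1 i1' in A'.
suff uu' : u = u' by rewrite Em Em' uu'.
rewrite i1 in C A' big; rewrite i1' in C' A'.
move: C C' A' big; rewrite !mulnDr !mulnA.
set c := carry l _; set c' := carry l _; set a := 3 ^ odds l _; set b := 3 ^ odds p _.
move=> C C' A' big.
have E : c + a * b * u = c' + a * b * u' by lia.
nia.
Qed.

Lemma regular_iter_bound h N m : regular h N m -> m < 2 ^ N ->
  iter N collatzT m <= 3 ^ odds N m + N * 2 ^ (2 * h).
Proof.
move=> reg mN; rewrite -(@leq_pmul2l (2 ^ N)) ?expn_gt0 // iter_affine.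
have := regular_suffix_carry h 0 N m reg; rewrite /= expnD => C.
by rewrite mulnDr; apply: leq_add; [rewrite mulnC leq_mul2r (ltnW mN) orbT | lia].
Qed.

(** * Counting below a power of two *)

Definition count_below (N : nat) (P : pred nat) : nat :=
  #|[set m : 'I_(2 ^ N) | P m]|.

(** [regular_inj] in counting form: [m] is recovered from a residue, a number of
    odd steps and a point of [B]. *)
Lemma card_pullback h p l M (B : pred nat) :
  (l * 2 ^ (l + 2 * h)) ^ 2 < 3 ^ (p + l - h) ->
  count_below (p + l) (fun m => [&& regular h (p + l) m,
      iter (p + l) collatzT m < 2 ^ M & B (iter (p + l) collatzT m)]) <=
  2 ^ p * (p + l).+1 * count_below M B.
Proof.
move=> small; rewrite /count_below.
have pos k : 0 < 2 ^ k by rewrite expn_gt0.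
pose f (m : 'I_(2 ^ (p + l))) : 'I_(2 ^ p) * 'I_(p + l).+1 * 'I_(2 ^ M) :=
  (Ordinal (ltn_pmod m (pos p)), inord (odds (p + l) m),
   insubd (Ordinal (pos M)) (iter (p + l) collatzT m)).
set A := [set m : 'I_(2 ^ (p + l)) | _].
have injf : {in A &, injective f}.
  move=> m m'; rewrite !inE => /and3P[reg lt _] /and3P[reg' lt' _].
  case=> eqm /(congr1 val) eqo /(congr1 val) eqT; apply: val_inj => /=.
  apply: (@regular_inj h p l) => //.
    by move: eqo; rewrite /= !inordK ?ltnS ?odds_le.
  by move: eqT; rewrite /= !val_insubd lt lt'.
rewrite -(card_in_imset injf).
rewrite -[X in _ <= X * _ * _](card_ord (2 ^ p)).
rewrite -[X in _ <= _ * X * _](card_ord (p + l).+1).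
rewrite -!cardsT -!cardsX; apply: subset_leq_card; apply/fintype.subsetP => y.
case/imsetP => m; rewrite inE => /and3P[reg lt Bm] ->.
by rewrite !inE /= val_insubd lt.
Qed.

Lemma count_sub N (P Q : pred nat) : (forall m, m < 2 ^ N -> P m -> Q m) ->
  count_below N P <= count_below N Q.
Proof.
move=> PQ; apply: subset_leq_card; apply/fintype.subsetP => m.
by rewrite !inE => /PQ; apply.
Qed.

Lemma count_orU N (P Q : pred nat) :
  count_below N (fun m => P m || Q m) <= count_below N P + count_below N Q.
Proof.
rewrite /count_below.
have -> : [set m : 'I_(2 ^ N) | P m || Q m] =
    [set m : 'I_(2 ^ N) | P m] :|: [set m : 'I_(2 ^ N) | Q m].
  by apply/setP => m; rewrite !inE.
by rewrite cardsU leq_subr.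
Qed.

Lemma count_bigU N n (P : nat -> pred nat) :
  count_below N (fun m => [exists i : 'I_n, P i m]) <=
  \sum_(i < n) count_below N (P i).
Proof.
rewrite /count_below.
have -> : [set m : 'I_(2 ^ N) | [exists i : 'I_n, P i m]] =
    \bigcup_(i < n) [set m : 'I_(2 ^ N) | P i m].
  apply/setP => m; rewrite inE; apply/existsP/bigcupP => [[i Pi]|[i _]].
    by exists i; rewrite ?inE.
  by rewrite inE; exists i.
elim/big_ind2: _ => [|A a C c Aa Cc|//]; first by rewrite cards0.
by rewrite cardsU (leq_trans (leq_subr _ _)) // leq_add.
Qed.

Lemma count_below_ltn N k : count_below N (fun m => m < k.+1) <= k.+1.
Proof.
rewrite /count_below -[leqRHS]card_ord.
rewrite -(card_in_imset (f := fun m : 'I_(2 ^ N) => inord m : 'I_k.+1)); first exact: max_card.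
move=> m m'; rewrite !inE => mk mk' /(congr1 val).
by rewrite /= !inordK // => /val_inj.
Qed.

End Combinatorics.

Section Density.
Variable R : realType.
Local Open Scope classical_set_scope.
Local Open Scope ring_scope.
Local Notation pow2 x := ((2 : R) `^ x).

Lemma big_pow2S (V : nmodType) N (F : nat -> V) :
  \sum_(0 <= m < 2 ^ N.+1) F m =
  \sum_(0 <= m < 2 ^ N) (F m + F (m + 2 ^ N)%N).
Proof.
rewrite expnS mul2n -addnn (@big_cat_nat _ _ _ (2 ^ N)%N) ?leq_addr //= big_split /=.
by rewrite -{2}[(2 ^ N)%N]add0n big_addn addnK.
Qed.

Implicit Types s : R.

(** * Deviations of the parity sequence *)

(** The likelihood ratio of a coin with bias [s] against a fair coin on the first
    [n] parities. *)
Definition walk_weight s n m : R :=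
  (1 + s) ^+ odds n m * (1 - s) ^+ (n - odds n m).

(** Among [m] and [m + 2 ^ n] exactly one has an odd [n]-th iterate, so the two
    new factors [1 + s] and [1 - s] average to 1. *)
Lemma sum_walk_weight s n N : (n <= N)%N ->
  \sum_(0 <= m < 2 ^ N) walk_weight s n m = 2 ^+ N.
Proof.
elim: N n => [|N IH] n.
  rewrite leqn0 => /eqP->; rewrite expn0 big_nat1 /walk_weight odds0.
  by rewrite !expr0 mulr1.
rewrite leq_eqVlt ltnS big_pow2S exprS => /predU1P[->|nN].
  rewrite -(IH N) // big_distrr; apply: eq_bigr => m _ /=.
  have [oN iN] := iter_shift N m 1; rewrite !muln1 in oN iN.
  rewrite /walk_weight !oddsS oN iN oddD oddX orbT addbT.
  have le := odds_le N m.
  case: odd; rewrite /= ?addn0 ?addn1 ?subSS (subSn le) !exprS; ring.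
rewrite -(IH n) // big_distrr; apply: eq_bigr => m _ /=.
rewrite /walk_weight -(muln1 (2 ^ N)%N) odds_shift //; ring.
Qed.

(** [(1 + s) ^ a (1 - s) ^ e] is [(1 - s ^ 2) ^ e (1 + s) ^ (a - e)], with
    [1 - s ^ 2 >= exp (- 2 s ^ 2)] and [1 + s >= exp (s / 2)] on this range of
    [s]. *)
Lemma chernoff_weight s (a e h N : nat) : 0 <= s <= 2^-1 ->
  (a + e <= N)%N -> (e + h <= a)%N ->
  expR (s * h%:R / 2 - 2 * s ^+ 2 * N%:R) <= (1 + s) ^+ a * (1 - s) ^+ e.
Proof.
move=> /andP[s0 s1] aeN eha.
have E1 : expR (s / 2) <= 1 + s.
  have : 1 + - (s / 2) <= expR (- (s / 2)) by exact: expR_ge1Dx.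
  rewrite expRN => le; have pos := expR_gt0 (s / 2).
  have : (1 - s / 2) * expR (s / 2) <= 1.
    by rewrite -[leRHS](mulVf (lt0r_neq0 pos)) ler_pM2r.
  nra.
have E2 : expR (- (2 * s ^+ 2)) <= (1 + s) * (1 - s).
  have : 1 + 2 * s ^+ 2 <= expR (2 * s ^+ 2) by exact: expR_ge1Dx.
  rewrite expRN => le; have pos := expR_gt0 (2 * s ^+ 2).
  rewrite -[leLHS]mulr1 ler_pdivrMl //.
  have s2 : 0 <= s ^+ 2 <= 2^-1 by apply/andP; split; nra.
  have : 1 <= (1 + 2 * s ^+ 2) * ((1 + s) * (1 - s)) by nra.
  move/le_trans; apply; rewrite ler_wpM2r //; nra.
have -> : (1 + s) ^+ a * (1 - s) ^+ e = ((1 + s) * (1 - s)) ^+ e * (1 + s) ^+ (a - e).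
  by rewrite exprMn mulrAC -exprD subnKC; [|lia].
rewrite expRD mulrC ler_pM ?expR_ge0 //.
  apply: le_trans (_ : expR (- (2 * s ^+ 2)) ^+ e <= _); last first.
    by rewrite lerXn2r ?nnegrE ?expR_ge0 ?(le_trans _ E2) ?expR_ge0.
  rewrite -expRM_natl ler_expR -mulr_natl.
  have : (e%:R : R) <= N%:R by rewrite ler_nat; lia.
  have : 0 <= s ^+ 2 by exact: sqr_ge0.
  nra.
apply: le_trans (_ : expR (s / 2) ^+ (a - e) <= _); last first.
  by rewrite lerXn2r ?nnegrE ?expR_ge0 ?(le_trans _ E1) ?expR_ge0.
rewrite -expRM_natl ler_expR.
have : (h%:R : R) <= (a - e)%:R by rewrite ler_nat; lia.
rewrite -mulr_natl; nra.
Qed.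

(** * Real powers of 2 *)

Lemma pow2D (x y : R) : pow2 (x + y) = pow2 x * pow2 y.
Proof. by rewrite powRD // pnatr_eq0 implybT. Qed.

Lemma ler_pow2 (x y : R) : x <= y -> pow2 x <= pow2 y.
Proof. by apply: ler_powR; rewrite ler1n. Qed.

Lemma ltr_pow2 (x y : R) : x < y -> pow2 x < pow2 y.
Proof. by move=> xy; rewrite /powR pnatr_eq0 ltr_expR ltr_pM2r // ln_gt0 ?ltr1n. Qed.

Lemma pow2_gt0 (x : R) : 0 < pow2 x.
Proof. by rewrite powR_gt0. Qed.

Lemma pow2_nat n : pow2 n%:R = (2 ^ n)%:R.
Proof. by rewrite powR_mulrn // natrX. Qed.

Lemma pow2_le_expR (x : R) : 0 <= x -> pow2 x <= expR x.
Proof.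
move=> x0; rewrite /powR pnatr_eq0 ler_expR ler_piMr // -[leRHS](@expRK R).
by rewrite ler_ln ?posrE ?expR_gt0 // (le_trans _ (expR_ge1Dx 1)) //; lra.
Qed.

Lemma ln2_gt0 : 0 < ln (2 : R).
Proof. by rewrite ln_gt0 ?ltr1n. Qed.

Lemma linear_absorb (c e : R) : 0 < e -> \forall N \near \oo, c <= e * N%:R.
Proof.
move=> e0; near=> N; rewrite -ler_pdivrMl // mulrC.
by near: N; exact: nbhs_infty_ger.
Unshelve. all: by end_near. Qed.

(** The form in which polynomial factors and constants are absorbed into
    exponentials. *)
Lemma pow2_absorb (c e : R) : 0 < e ->
  \forall N \near \oo, c * N.+1%:R <= pow2 (e * N%:R).
Proof.
move=> e0; set k := e * ln 2 / 2.
have k0 : 0 < k by rewrite divr_gt0 ?mulr_gt0 ?ln2_gt0.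
near=> N.
have -> : pow2 (e * N%:R) = expR (k * N%:R) ^+ 2.
  by rewrite -expRM_natl /powR pnatr_eq0 /k; congr expR; field.
have N1 : (1 : R) <= N%:R by rewrite ler1n; near: N; exact: nbhs_infty_ge.
have cN : 2 * c <= k ^+ 2 * N%:R by near: N; apply: linear_absorb; rewrite exprn_gt0.
apply: le_trans (_ : (k * N%:R) ^+ 2 <= _).
  rewrite -natr1; have := ler0n R N.
  have [c0|c0] := leP 0 c; last by have := sqr_ge0 (k * N%:R); nra.
  by move=> _; rewrite exprMn; nra.
have kN : 0 <= k * N%:R by rewrite mulr_ge0 // ltW.
rewrite lerXn2r ?nnegrE ?expR_ge0 //.
by apply: le_trans (expR_ge1Dx _); rewrite lerDr.
Unshelve. all: by end_near. Qed.

(** * Irregular integers are rare *)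

Lemma count_markov (w : nat -> R) (t : R) N (P : pred nat) :
  (forall m, 0 <= w m) -> (forall m, P m -> t <= w m) ->
  t * (count_below N P)%:R <= \sum_(0 <= m < 2 ^ N) w m.
Proof.
move=> w0 tw; rewrite big_mkord mulr_natr /count_below -sumr_const.
rewrite [X in X <= _]big_mkcond /=; apply: ler_sum => m _.
by rewrite inE; case: ifP => [/tw|].
Qed.

(** Markov's inequality for the weight with bias [s] or [- s]. *)
Lemma count_deviation (s : R) i h N (P : pred nat) : 0 <= s <= 2^-1 ->
  (i <= N)%N ->
  ((forall m, P m -> i - odds i m + h <= odds i m)%N \/
   (forall m, P m -> odds i m + h <= i - odds i m)%N) ->
  (count_below N P)%:R <= 2 ^+ N * expR (2 * s ^+ 2 * N%:R - s * h%:R / 2).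
Proof.
move=> s01 iN dev.
have -> : 2 * s ^+ 2 * N%:R - s * h%:R / 2 = - (s * h%:R / 2 - 2 * s ^+ 2 * N%:R) by ring.
rewrite expRN ler_pdivlMr ?expR_gt0 // mulrC.
have [u us iw] : exists2 u : R, (`|u| <= 2^-1) & forall m, P m ->
    expR (s * h%:R / 2 - 2 * s ^+ 2 * N%:R) <= walk_weight u i m.
  have odi := odds_le i.
  have ns : `|s| <= 2^-1 by rewrite ger0_norm; case/andP: s01.
  case: dev => dev; [exists s => // m /dev le|exists (- s); rewrite ?normrN // => m /dev le].
    by apply: chernoff_weight => //; have := odi m; lia.
  rewrite /walk_weight opprK [leRHS]mulrC.
  by apply: chernoff_weight => //; have := odi m; lia.
rewrite -(sum_walk_weight u i N iN); apply: count_markov => // m.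
move: us; rewrite ler_norml => us.
by rewrite mulr_ge0 // exprn_ge0 //; lra.
Qed.

Lemma count_irregular (s : R) h N : 0 <= s <= 2^-1 ->
  (count_below N (fun m => ~~ regular h N m))%:R <=
  2 * N.+1%:R * (2 ^+ N * expR (2 * s ^+ 2 * N%:R - s * h%:R / 2)).
Proof.
move=> s01; set K := (X in _ * _ * X).
pose above (i m : nat) := (i - odds i m + h <= odds i m)%N.
pose below (i m : nat) := (odds i m + h <= i - odds i m)%N.
apply: le_trans (_ : (\sum_(i < N.+1) (count_below N (above i) + count_below N (below i)))%:R <= _).
  rewrite ler_nat.
  apply: (@leq_trans (\sum_(i < N.+1) count_below N (fun m => above i m || below i m))); last first.
    by apply: leq_sum => i _; exact: count_orU.
  apply: leq_trans (count_bigU _ _ (fun i m => above i m || below i m)).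
  apply: count_sub => m _; rewrite negb_forall => /existsP[i].
  rewrite negb_and -!ltnNge => dev; apply/existsP; exists i; rewrite /above /below.
  by have := odds_le i m; lia.
rewrite natr_sum -mulrA mulrCA mulr_natl -[X in _ *+ X](card_ord N.+1) -sumr_const.
apply: ler_sum => i _; rewrite natrD mulr_natl mulr2n.
have iN : (i <= N)%N by rewrite -ltnS.
by apply: lerD; apply: (@count_deviation s i) => //; [left|right].
Qed.

(** * Sparse families *)

Definition sparse (B : nat -> pred nat) : Prop :=
  exists2 d : R, 0 < d &
    \forall N \near \oo, (count_below N (B N))%:R <= pow2 ((1 - d) * N%:R).

Lemma sparse_sub (B B' : nat -> pred nat) :
  (\forall N \near \oo, forall m, (m < 2 ^ N)%N -> B N m -> B' N m) ->
  sparse B' -> sparse B.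
Proof.
move=> BB' [d d0 HB']; exists d => //; near=> N.
apply: (@le_trans _ _ (count_below N (B' N))%:R); last by near: N.
by rewrite ler_nat; apply: count_sub; near: N.
Unshelve. all: by end_near. Qed.

Lemma sparseU (B B' : nat -> pred nat) : sparse B -> sparse B' ->
  sparse (fun N m => B N m || B' N m).
Proof.
move=> [d d0 HB] [d' d'0 HB'].
(* Half of the smaller exponent, so that the other half absorbs the factor 2. *)
pose e := Num.min d d' / 2.
have m0 : 0 < Num.min d d' by rewrite lt_min d0.
have e0 : 0 < e by rewrite divr_gt0.
have [ed ed'] : 2 * e <= d /\ 2 * e <= d'.
  have -> : 2 * e = Num.min d d' by rewrite /e; field.
  by rewrite !ge_min !lexx orbT.
exists e => //; near=> N.
apply: (@le_trans _ _ ((count_below N (B N))%:R + (count_below N (B' N))%:R)).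
  by rewrite -natrD ler_nat count_orU.
have N0 := ler0n R N.
have H1 : (count_below N (B N))%:R <= pow2 ((1 - 2 * e) * N%:R).
  apply: (@le_trans _ _ (pow2 ((1 - d) * N%:R))); first by near: N.
  by apply: ler_pow2; nra.
have H2 : (count_below N (B' N))%:R <= pow2 ((1 - 2 * e) * N%:R).
  apply: (@le_trans _ _ (pow2 ((1 - d') * N%:R))); first by near: N.
  by apply: ler_pow2; nra.
have H3 : 2 * N.+1%:R <= pow2 (e * N%:R) by near: N; exact: pow2_absorb.
have -> : (1 - e) * N%:R = (1 - 2 * e) * N%:R + e * N%:R by ring.
rewrite pow2D; have := pow2_gt0 ((1 - 2 * e) * N%:R).
have : (1 : R) <= N.+1%:R by rewrite ler1n.
nra.
Unshelve. all: by end_near. Qed.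

(** The bias [s = e / 8] makes the exponent [2 s ^ 2 - s e / 2] of
    [count_irregular] equal to [- e ^ 2 / 32] per step. *)
Lemma sparse_irregular (e : R) : 0 < e <= 1 ->
  sparse (fun N m => ~~ regular (Num.truncn (e * N%:R)) N m).
Proof.
move=> /andP[e0 e1]; pose d := e ^+ 2 / 96.
have d0 : 0 < d by rewrite divr_gt0 // exprn_gt0.
exists d => //; near=> N; set h := Num.truncn _.
have s01 : 0 <= e / 8 <= 2^-1 by apply/andP; split; lra.
apply: (le_trans (count_irregular _ h N s01)).
have hN : e * N%:R < h%:R + 1 by rewrite natr1 truncnS_gt.
have N0 := ler0n R N.
have E : expR (2 * (e / 8) ^+ 2 * N%:R - e / 8 * h%:R / 2) <=
         expR 1 * pow2 (- (2 * d) * N%:R).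
  rewrite mulNr powRN ler_pdivlMr ?pow2_gt0 //.
  have P := pow2_le_expR (2 * d * N%:R) ltac:(by rewrite !mulr_ge0 // ltW).
  apply: le_trans (_ : expR 1 * expR (- (2 * d * N%:R)) * pow2 (2 * d * N%:R) <= _).
    rewrite ler_wpM2r ?powR_ge0 // -expRD ler_expR /d.
    have : e / 8 * (e * N%:R) <= e / 8 * (h%:R + 1) by rewrite ler_pM2l ?divr_gt0 // ltW.
    nra.
  rewrite -mulrA ler_piMr ?expR_ge0 // expRN ler_pdivrMl ?expR_gt0 //.
  by rewrite mulr1.
have A : 2 * expR 1 * N.+1%:R <= pow2 (d * N%:R) by near: N; exact: pow2_absorb.
have -> : (1 - d) * N%:R = N%:R + (- (2 * d) * N%:R) + d * N%:R by ring.
rewrite 2!pow2D pow2_nat natrX.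
set X := 2 ^+ N; set Y := pow2 (- _ * _) in E *.
have X0 : 0 < X by rewrite exprn_gt0.
have Y0 : 0 < Y by rewrite pow2_gt0.
apply: le_trans (_ : 2 * N.+1%:R * (X * (expR 1 * Y)) <= _).
  by rewrite ler_wpM2l ?mulr_ge0 // ler_wpM2l // ltW.
have -> : 2 * N.+1%:R * (X * (expR 1 * Y)) = X * Y * (2 * expR 1 * N.+1%:R) by ring.
by rewrite ler_wpM2l // mulr_ge0 // ltW.
Unshelve. all: by end_near. Qed.

(** One step multiplies by [2 ^ (L - 1)] in geometric mean: by 1/2 or by about
    3/2, equally often. *)
Let L : R := log2 (Num.sqrt 3).

Lemma L_half : pow2 (2 * L) = 3.
Proof.
have l0 := ln2_gt0.
rewrite /powR pnatr_eq0 /L /log2 -powR12_sqrt // ln_powR.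
have -> : 2 * (2^-1 * ln 3 / ln 2) * ln 2 = ln (3 : R) by field; rewrite gt_eqF.
by rewrite lnK ?posrE.
Qed.

Lemma L_bounds : 0 < L < 1.
Proof.
have l0 := ln2_gt0; rewrite /L /log2 -powR12_sqrt // ln_powR.
have l3 : 0 < ln (3 : R) by rewrite ln_gt0 ?ltr1n.
have : ln (3 : R) < ln (2 ^+ 2) by rewrite ltr_ln ?posrE // -natrX ltr_nat.
rewrite lnXn // mulr2n => l4.
by rewrite divr_gt0 ?mulr_gt0 //= ltr_pdivrMr //; lra.
Qed.

Lemma pow3 n : (3 ^ n)%:R = pow2 (2 * L * n%:R).
Proof. by rewrite powRrM L_half powR_mulrn // natrX. Qed.

(** * One round of N steps *)

(** The number of binary digits allowed for the [N]-th iterate of a regular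
    integer below [2 ^ N]. *)
Definition next_scale (e : R) N := (Num.truncn ((L + 2 * e) * N%:R)).+1.

(** The slope is at most [2 ^ (L (N + h))] and the carry adds at most
    [N 4 ^ h], both below [2 ^ ((L + e) N)] up to the factor [N]. *)
Lemma regular_iter_below (e : R) : 0 < e <= L ->
  \forall N \near \oo, forall m, (m < 2 ^ N)%N ->
    regular (Num.truncn (e * N%:R)) N m ->
    (iter N collatzT m < 2 ^ next_scale e N)%N.
Proof.
move=> /andP[e0 eL]; have /andP[L0 L1] := L_bounds; near=> N => m mN reg.
have N0 := ler0n R N.
have hN : (Num.truncn (e * N%:R))%:R <= e * N%:R.
  by rewrite truncn_le mulr_ge0 // ltW.
set h := Num.truncn _ in reg hN.
have up := regular_odds_upper _ _ _ reg.
have bd := regular_iter_bound _ _ _ reg mN.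
have A : 1 * N.+1%:R <= pow2 (e * N%:R) by near: N; exact: pow2_absorb.
rewrite -(ltr_nat R) -!pow2_nat.
have O : (3 ^ odds N m)%:R <= pow2 ((L + e) * N%:R).
  rewrite -(@ler_pXn2r _ 2) ?nnegrE ?powR_ge0 //.
  apply: le_trans (_ : (3 ^ (N + h))%:R <= _); first by rewrite -natrX ler_nat.
  rewrite pow3 -powR_mulrn ?powR_ge0 // -powRrM; apply: ler_pow2.
  have : L * h%:R <= h%:R by rewrite ler_piMl // ltW.
  rewrite natrD; nra.
have C : (2 ^ (2 * h))%:R <= pow2 ((L + e) * N%:R).
  by rewrite -pow2_nat; apply: ler_pow2; rewrite natrM; nra.
apply: le_lt_trans (_ : pow2 ((L + 2 * e) * N%:R) < _); last first.
  by apply: ltr_pow2; rewrite truncnS_gt.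
apply: le_trans (_ : (3 ^ odds N m)%:R + N%:R * (2 ^ (2 * h))%:R <= _).
  by rewrite -natrM -natrD ler_nat.
have -> : (L + 2 * e) * N%:R = (L + e) * N%:R + e * N%:R by ring.
rewrite pow2D; have := pow2_gt0 ((L + e) * N%:R).
move: A; rewrite -natr1; nra.
Unshelve. all: by end_near. Qed.

Lemma next_scale_bounds (e : R) N : 0 <= e ->
  (L + 2 * e) * N%:R <= (next_scale e N)%:R <= (L + 2 * e) * N%:R + 1.
Proof.
move=> e0; have /andP[L0 _] := L_bounds.
rewrite ltW ?truncnS_gt //= /next_scale; set x := _ * N%:R.
by rewrite -(natr1 (Num.truncn x)) lerD2r truncn_le /x mulr_ge0 //; lra.
Qed.

(** With [l ~ L N], a point has at most about [2 ^ ((1 - L) N)] regular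
    preimages, so a set of [2 ^ ((1 - d) L N)] points has at most about
    [2 ^ ((1 - d L) N)] of them.  All the errors are [O(e N)] in the exponent,
    whence [e] small compared with [d L]. *)
Lemma sparse_pullback (B : nat -> pred nat) : sparse B ->
  exists2 e0 : R, 0 < e0 & forall e, 0 < e <= e0 ->
    sparse (fun N m => [&& regular (Num.truncn (e * N%:R)) N m,
      (iter N collatzT m < 2 ^ next_scale e N)%N &
      B (next_scale e N) (iter N collatzT m)]).
Proof.
move=> [d' d'0 HB']; have /andP[L0 L1] := L_bounds.
pose d := Num.min d' 1.
have d0 : 0 < d by rewrite lt_min d'0 ltr01.
have d1 : d <= 1 by rewrite ge_min lexx orbT.
have dd' : d <= d' by rewrite ge_min lexx.
pose d2 := d * L / 2; have d20 : 0 < d2 by rewrite /d2 divr_gt0 // mulr_gt0.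
have e00 : 0 < d * L / 24 by rewrite divr_gt0 // mulr_gt0.
exists (d * L / 24) => // e /andP[e0 eL]; exists d2 => //.
have dL : d * L <= L by rewrite ler_piMl // ltW.
have [N0 _ HB] := HB'.
near=> N; set h := Num.truncn _; set M := next_scale e N.
have Nge0 := ler0n R N.
have hN : h%:R <= e * N%:R by rewrite truncn_le mulr_ge0 // ltW.
(* [l + 2 h] is below [L (N - h)] with room for the factor [l]: the largest
   choice, up to O(e N), for which the hypothesis of [card_pullback] holds. *)
pose l := Num.truncn ((L - 5 * e) * N%:R).
have /andP[l1 l2] : l%:R <= (L - 5 * e) * N%:R < l.+1%:R.
  by apply: truncn_itv; rewrite mulr_ge0 //; lra.
have lN : (l <= N)%N by rewrite -(ler_nat R); nra.
have A : 4 * N.+1%:R <= pow2 (e * N%:R) by near: N; exact: pow2_absorb.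
have NpL : N = (N - l + l)%N by rewrite subnK.
have small : ((l * 2 ^ (l + 2 * h)) ^ 2 < 3 ^ (N - l + l - h))%N.
  rewrite -NpL -(ltr_nat R) pow3 natrX natrM -pow2_nat natrD natrM.
  have hleN : (h <= N)%N by rewrite -(ler_nat R); nra.
  have -> : pow2 (2 * L * (N - h)%:R) = pow2 (L * (N - h)%:R) ^+ 2.
    by rewrite -[RHS]powR_mulrn ?powR_ge0 // -powRrM; congr (_ `^ _); ring.
  rewrite ltrXn2r ?mulr_ge0 ?powR_ge0 //.
  apply: lt_le_trans (_ : pow2 (e * N%:R) * pow2 ((L - 3 * e) * N%:R) <= _); last first.
    have : L * h%:R <= h%:R by rewrite ler_piMl // ltW.
    by move=> Lh; rewrite -pow2D; apply: ler_pow2; rewrite natrB //; nra.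
  have lt1 : l%:R < pow2 (e * N%:R).
    apply: le_lt_trans (_ : N%:R < _); first by rewrite ler_nat.
    by move: A; rewrite -natr1; lra.
  apply: lt_le_trans (_ : pow2 (e * N%:R) * pow2 (l%:R + 2 * h%:R) <= _).
    by rewrite ltr_pM2r ?pow2_gt0.
  by rewrite ler_wpM2l ?powR_ge0 //; apply: ler_pow2; lra.
have := card_pullback h (N - l) l M (B M) small; rewrite -NpL => cnt.
have /andP[M1 M2] := next_scale_bounds e N (ltW e0).
have HM : (count_below M (B M))%:R <= pow2 ((1 - d') * M%:R).
  apply: HB => /=; rewrite -(ler_nat R); apply: le_trans M1.
  near: N; apply: linear_absorb; lra.
apply: le_trans (_ : pow2 (N - l)%:R * N.+1%:R * (count_below M (B M))%:R <= _).
  by rewrite pow2_nat -!natrM ler_nat.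
apply: le_trans (_ : pow2 ((1 - L + 5 * e) * N%:R + 1) * N.+1%:R *
                     pow2 ((L - d * L + 2 * e) * N%:R + 1) <= _).
  have E1 : pow2 (N - l)%:R <= pow2 ((1 - L + 5 * e) * N%:R + 1).
    by apply: ler_pow2; rewrite natrB //; move: l2; rewrite -natr1; nra.
  have E2 : pow2 ((1 - d') * M%:R) <= pow2 ((L - d * L + 2 * e) * N%:R + 1).
    apply: ler_pow2; apply: le_trans (_ : (1 - d) * M%:R <= _).
      by rewrite ler_wpM2r ?lerB.
    apply: le_trans (_ : (1 - d) * ((L + 2 * e) * N%:R + 1) <= _).
      by rewrite ler_wpM2l // subr_ge0.
    have : 0 <= d * (e * N%:R) by rewrite !mulr_ge0 // ltW.
    nra.
  rewrite ler_pM ?mulr_ge0 ?powR_ge0 ?ler_wpM2r //.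
  exact: le_trans E2.
have -> : pow2 ((1 - L + 5 * e) * N%:R + 1) * N.+1%:R *
          pow2 ((L - d * L + 2 * e) * N%:R + 1) =
          pow2 ((1 - d * L + 7 * e) * N%:R) * (4 * N.+1%:R).
  have -> : (1 - d * L + 7 * e) * N%:R = (1 - L + 5 * e) * N%:R + (L - d * L + 2 * e) * N%:R by ring.
  by rewrite !pow2D powRr1 //; ring.
apply: le_trans (_ : pow2 ((1 - d * L + 7 * e) * N%:R) * pow2 (e * N%:R) <= _).
  by rewrite ler_wpM2l ?powR_ge0.
rewrite -pow2D; apply: ler_pow2; rewrite /d2; nra.
Unshelve. all: by end_near. Qed.

(** * Iterating the rounds *)

(** An orbit that is above 2 at time [n] has not yet entered the cycle 1, 2, so
    its total stopping time is at least [n]; the upper bound on the iterate limits the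
    time that remains. *)
Definition typical (k s e : R) (N m : nat) : Prop :=
  exists n, [/\ `|n%:R - k * N%:R| <= e * N%:R, (2 < iter n collatzT m)%N &
    (iter n collatzT m)%:R <= pow2 ((s + e) * N%:R)].

Definition atypical (k s e : R) (N : nat) : pred nat :=
  fun m => ~~ `[< typical k s e N m >].

(** Only 0, 1 and 2 are atypical at time 0. *)
Lemma atypical_start (e : R) : 0 < e -> sparse (atypical 0 1 e).
Proof.
move=> e0; exists 2^-1; first by rewrite invr_gt0.
near=> N; have N0 := ler0n R N.
apply: (@le_trans _ _ 3); last first.
  have : 3 * N.+1%:R <= pow2 (2^-1 * N%:R) by near: N; apply: pow2_absorb; rewrite invr_gt0.
  have -> : 1 - 2^-1 = 2^-1 :> R by lra.
  by apply: le_trans; rewrite ler_peMr // ler1n.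
rewrite ler_nat; apply: leq_trans (count_below_ltn N 2).
apply: count_sub => m mN; rewrite ltnNge => /asboolPn; apply: contra_notN => m3.
exists 0%N; split => //=.
  by rewrite mul0r subr0 normr0 mulr_ge0 // ltW.
apply: (@le_trans _ _ (pow2 N%:R)); first by rewrite pow2_nat ler_nat ltnW.
by apply: ler_pow2; nra.
Unshelve. all: by end_near. Qed.

(** If [m] is regular and [iter N collatzT m] is typical at its own scale
    [M ~ L N], then [m] has waited [N] steps before a time [k M ~ k L N] and a
    size [2 ^ (s M) ~ 2 ^ (s L N)]. *)
Lemma atypical_step (k s : R) : 0 <= k -> 0 <= s ->
  (forall e : R, 0 < e -> sparse (atypical k s e)) ->
  forall e : R, 0 < e -> sparse (atypical (1 + L * k) (L * s) e).
Proof.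
move=> k0 s0 IH e e0; have /andP[L0 L1] : 0 < L < 1 := L_bounds.
have e40 : 0 < e / 4 by rewrite divr_gt0.
have [b0 b00 pull] := sparse_pullback _ (IH _ e40).
(* The scale of the next round is [M ~ (L + 2 b) N]: the factor [D] keeps the
   effect of [2 b] on [k M] and [s M] below [e N / 8]. *)
pose D := 16 * (k + s + 1).
have D0 : 0 < D by rewrite /D mulr_gt0 // ltr_wpDl // addr_ge0.
pose b := Num.min (Num.min b0 (L / 2)) (e / D).
have L2 : 0 < L / 2 by apply: divr_gt0.
have b_gt0 : 0 < b by rewrite /b !lt_min b00 L2 divr_gt0.
have bb0 : b <= b0 by rewrite !ge_min lexx.
have bL : b <= L / 2 by rewrite !ge_min lexx orbT.
have bD : b * D <= e by rewrite -ler_pdivlMr // ge_min lexx orbT.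
have bL' : 0 < b <= L by rewrite b_gt0; lra.
have b1 : 0 < b <= 1 by rewrite b_gt0; lra.
have bb : 0 < b <= b0 by rewrite b_gt0.
apply: sparse_sub (sparseU _ _ (sparse_irregular _ b1) (pull b bb)).
near=> N => m mN /asboolPn; apply: contra_notT.
rewrite negb_or negbK => /andP[reg].
have lt : (iter N collatzT m < 2 ^ next_scale b N)%N.
  by move: m mN reg; near: N; exact: regular_iter_below.
rewrite reg lt /= negbK => /asboolP[n [n1 n2 n3]].
have /andP[M1 M2] := next_scale_bounds b N (ltW b_gt0).
move: (next_scale b N) M1 M2 n1 n3 => M M1 M2 n1 n3.
have N0 := ler0n R N.
have N1 : k + s + 1 <= e / 8 * N%:R by near: N; apply: linear_absorb; rewrite divr_gt0.
have Ng : (1 : R) <= 1 * N%:R by near: N; exact: linear_absorb.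
have bkN : 16 * (b * (k * N%:R)) + 16 * (b * (s * N%:R)) + 16 * (b * N%:R) <= e * N%:R.
  have := ler_wpM2r N0 bD; rewrite /D; lra.
have bsN0 : 0 <= b * (s * N%:R) by rewrite !mulr_ge0 // ltW.
have bkN0 : 0 <= b * (k * N%:R) by rewrite !mulr_ge0 // ltW.
have bN0 : 0 <= b * N%:R by rewrite mulr_ge0 // ltW.
have LN : L * N%:R <= N%:R by rewrite ler_piMl // ltW.
have b2N : 2 * b * N%:R <= N%:R by rewrite ler_piMl //; lra.
have M3 : M%:R <= 3 * N%:R :> R by lra.
have M4 : e / 4 * M%:R <= 3 / 4 * (e * N%:R).
  by have := ler_wpM2l (ltW e40) M3; lra.
have kM1 : k * (L * N%:R + 2 * (b * N%:R)) <= k * M%:R by apply: ler_wpM2l => //; lra.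
have kM2 : k * M%:R <= k * (L * N%:R + 2 * (b * N%:R) + 1) by apply: ler_wpM2l => //; lra.
have sM2 : s * M%:R <= s * (L * N%:R + 2 * (b * N%:R) + 1) by apply: ler_wpM2l => //; lra.
exists (n + N)%N; rewrite iterD; split => //.
  move: n1; rewrite !ler_norml natrD => /andP[n1 n1']; apply/andP; split; lra.
by apply: (le_trans n3); apply: ler_pow2; lra.
Unshelve. all: by end_near. Qed.

Lemma atypical_sparse j (e : R) : 0 < e ->
  sparse (atypical ((1 - L ^+ j) / (1 - L)) (L ^+ j) e).
Proof.
have /andP[L0 L1] : 0 < L < 1 := L_bounds.
elim: j e => [|j IH] e e0.
  by rewrite expr0 subrr mul0r; exact: atypical_start.
have -> : (1 - L ^+ j.+1) / (1 - L) = 1 + L * ((1 - L ^+ j) / (1 - L)).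
  by rewrite exprS; field; lra.
rewrite exprS; apply: atypical_step => //; last by rewrite exprn_ge0 // ltW.
by rewrite divr_ge0 // subr_ge0 ?exprn_ile1 // ltW.
Qed.

Lemma log2_pow2 (x : R) : log2 (pow2 x) = x.
Proof. by rewrite /log2 ln_powR mulfK // gt_eqF // ln2_gt0. Qed.

Lemma ler_log2 (x y : R) : 0 < x -> x <= y -> log2 x <= log2 y.
Proof.
move=> x0 xy; rewrite /log2 ler_pM2r ?invr_gt0 ?ln2_gt0 //.
by rewrite ler_ln ?posrE // (lt_le_trans x0).
Qed.

(** * Stopping times *)

Section BoundedStopping.
Let c : R := 1 / (1 - L).
Variables (C : R) (tau : nat -> nat).
Hypothesis C0 : 0 < C.
Hypothesis tau_reach : forall m, (0 < m)%N -> iter (tau m) collatzT m = 1%N.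
Hypothesis tau_min : forall m n, (0 < m)%N -> iter n collatzT m = 1%N -> (tau m <= n)%N.
Hypothesis tau_log : forall m, (0 < m)%N -> (tau m)%:R <= C * log2 m%:R.

Lemma tau_lower m n : (2 < iter n collatzT m)%N -> (0 < m)%N -> (n <= tau m)%N.
Proof.
move=> big m0; rewrite leqNgt; apply/negP => lt.
move: big; rewrite -(subnK (ltnW lt)) iterD tau_reach // ltnNge.
by rewrite iter_collatzT_1.
Qed.

Lemma tau_upper m n : (0 < m)%N -> (tau m <= n + tau (iter n collatzT m))%N.
Proof.
move=> m0; apply: tau_min => //.
by rewrite addnC iterD tau_reach // iter_collatzT_pos.
Qed.

Lemma tau_typical (k s e : R) N m : typical k s e N m ->
  (k - e) * N%:R <= (tau m)%:R <= (k + e + C * (s + e)) * N%:R.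
Proof.
case=> n [n1 n2 n3].
have m0 : (0 < m)%N.
  rewrite lt0n; apply: contraL n2 => /eqP->; rewrite -leqNgt.
  by rewrite (_ : iter n collatzT 0 = 0%N) //; elim: n {n1 n3} => //= n ->.
have lo := tau_lower _ _ n2 m0; have up := tau_upper m n m0.
have Tpos : (0 < iter n collatzT m)%N by rewrite iter_collatzT_pos.
have := tau_log _ Tpos.
have : log2 (iter n collatzT m)%:R <= (s + e) * N%:R.
  by rewrite -[leRHS]log2_pow2; apply: ler_log2; rewrite ?ltr0n.
move=> /(ler_wpM2l (ltW C0)) l1 l2.
move: lo up; rewrite -!(ler_nat R) natrD => lo up.
by move: n1; rewrite ler_norml => n1; lra.
Qed.

(** As [(1 - L ^ j) / (1 - L) = c - c L ^ j], choosing [j] with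
    [(c + C) L ^ j] small makes both the time still missing and the bound
    [C L ^ j N] on it negligible. *)
Lemma tau_concentrated (e : R) : 0 < e -> exists2 B, sparse B &
  forall N m, ~~ B N m -> `|(tau m)%:R - c * N%:R| <= e * N%:R.
Proof.
move=> e0; have /andP[L0 L1] : 0 < L < 1 := L_bounds.
have c0 : 0 < c by rewrite /c divr_gt0 // subr_gt0.
have [j Lj] : exists j, (c + C) * L ^+ j <= e / 2.
  have : (fun j => (c + C) * L ^+ j) @ \oo --> (c + C) * 0.
    by apply: cvgMl_tmp; apply: cvg_expr; rewrite ger0_norm // ltW.
  rewrite mulr0 => /cvgrPdist_le /(_ (e / 2)) /(_ ltac:(by rewrite divr_gt0)) [j _ /(_ j)].
  rewrite /= leqnn sub0r normrN => /(_ isT) H; exists j.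
  by apply: le_trans H; exact: ler_norm.
pose d := e / (2 * (1 + C)).
have C1 : 0 < 2 * (1 + C) by rewrite mulr_gt0 // addr_gt0.
have d0 : 0 < d by rewrite /d divr_gt0.
have dC : d * (1 + C) = e / 2 by rewrite /d; field; rewrite gt_eqF // addr_gt0.
exists (atypical ((1 - L ^+ j) / (1 - L)) (L ^+ j) d); first exact: atypical_sparse.
move=> N m; rewrite negbK => /asboolP /tau_typical.
have -> : (1 - L ^+ j) / (1 - L) = c - c * L ^+ j by rewrite /c; field; lra.
have Lj0 : 0 <= L ^+ j by rewrite exprn_ge0 // ltW.
have N0 := ler0n R N; have := ler_wpM2r N0 Lj.
have CL : 0 <= C * L ^+ j * N%:R by rewrite !mulr_ge0 // ltW.
have cL : 0 <= c * L ^+ j * N%:R by rewrite mulr_ge0 // mulr_ge0 // ltW.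
have Cd : 0 <= C * d * N%:R by rewrite mulr_ge0 // mulr_ge0 // ltW.
have dN := congr1 (fun x => x * N%:R) dC.
by move=> LjN /andP[lo up]; rewrite ler_norml; apply/andP; split; lra.
Qed.

Lemma sum_below_count N K (B : pred nat) : (K < 2 ^ N)%N ->
  \sum_(1 <= m < K.+1) (B m)%:R <= (count_below N B)%:R :> R.
Proof.
move=> KN; have -> : (count_below N B)%:R = \sum_(0 <= m < 2 ^ N) (B m)%:R :> R.
  rewrite big_mkord /count_below -sumr_const big_mkcond /=.
  by apply: eq_bigr => m _; rewrite inE; case: (B m).
rewrite (@big_cat_nat _ _ _ 1 0 (2 ^ N)) ?expn_gt0 //= (@big_cat_nat _ _ _ K.+1 1 (2 ^ N)) //=.
by rewrite addrCA lerDl addr_ge0 // sumr_ge0.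
Qed.

(** Inside the exceptional family the stopping time is still at most [C N], and
    that family has at most [2 ^ ((1 - d) N)] elements, which is [o(K)]. *)
Lemma tau_sum (e : R) : 0 < e -> \forall N \near \oo, forall K,
  (2 ^ N <= 2 * K)%N -> (K < 2 ^ N)%N ->
  `|\sum_(1 <= m < K.+1) (tau m)%:R - c * N%:R * K%:R| <= e * N%:R * K%:R.
Proof.
move=> e0; have e20 : 0 < e / 2 by rewrite divr_gt0.
have /andP[L0 L1] : 0 < L < 1 := L_bounds.
have c0 : 0 < c by rewrite /c divr_gt0 // subr_gt0.
have [B [d d0 HB] conc] := tau_concentrated _ e20.
near=> N => K KN1 KN2; have N0 := ler0n R N.
have -> : c * N%:R * K%:R = \sum_(1 <= m < K.+1) (c * N%:R).
  by rewrite sumr_const_nat subn1 /= mulr_natr.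
rewrite -sumrB; apply: (le_trans (ler_norm_sum _ _ _)).
apply: (@le_trans _ _ (\sum_(1 <= m < K.+1) (e / 2 * N%:R + (C + c) * N%:R * (B N m)%:R))).
  rewrite 2!big_nat; apply: ler_sum => m /andP[m1 mK].
  case: (boolP (B N m)) => [_|/conc le]; last by rewrite mulr0 addr0.
  have : log2 m%:R <= N%:R :> R.
    rewrite -[leRHS]log2_pow2; apply: ler_log2; rewrite ?ltr0n // pow2_nat ler_nat.
    by apply: leq_trans (ltnW KN2); rewrite -ltnS.
  move=> /(ler_wpM2l (ltW C0)) /(le_trans (tau_log _ m1)) up.
  have t0 := ler0n R (tau m).
  have cN : 0 <= c * N%:R by rewrite mulr_ge0 // ltW.
  have eN : 0 <= e * N%:R by rewrite mulr_ge0 // ltW.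
  have CN : 0 <= C * N%:R by rewrite mulr_ge0 // ltW.
  by rewrite ler_norml mulr1; apply/andP; split; lra.
rewrite big_split /= sumr_const_nat subn1 /= -mulr_natr -big_distrr /=.
have bad : (C + c) * \sum_(1 <= m < K.+1) (B N m)%:R <= e / 2 * K%:R.
  apply: (@le_trans _ _ ((C + c) * pow2 ((1 - d) * N%:R))).
    apply: ler_wpM2l; first by rewrite addr_ge0 // ltW.
    apply: (le_trans (sum_below_count N K (B N) KN2)).
    by near: N.
  have A : (4 * (C + c) / e) * N.+1%:R <= pow2 (d * N%:R) by near: N; exact: pow2_absorb.
  have P : pow2 N%:R = pow2 ((1 - d) * N%:R) * pow2 (d * N%:R).
    by rewrite -pow2D; congr (_ `^ _); ring.
  have {}A : 4 * (C + c) <= e * pow2 (d * N%:R).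
    rewrite [leRHS]mulrC -ler_pdivrMr //; apply: le_trans A.
    by rewrite ler_peMr ?ler1n // divr_ge0 ?mulr_ge0 ?addr_ge0 // ltW.
  have := ler_wpM2r (powR_ge0 2 ((1 - d) * N%:R)) A.
  have -> : e * pow2 (d * N%:R) * pow2 ((1 - d) * N%:R) = e * pow2 N%:R by rewrite P; ring.
  have : pow2 N%:R <= 2 * K%:R by rewrite pow2_nat -natrM ler_nat.
  move=> /(ler_wpM2l (ltW e0)); lra.
have := ler_wpM2r N0 bad; lra.
Unshelve. all: by end_near. Qed.

(** For [2 ^ (N - 1) <= x < 2 ^ N] the product of [N] and the integer part of [x]
    differs from [x log2 x] by at most [x + log2 x]. *)
Lemma tau_average :
  1 / (x * log2 x) * \sum_(1 <= m < (Num.truncn x).+1) (tau m)%:R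
    @[x --> +oo] --> c.
Proof.
have /andP[L0 L1] : 0 < L < 1 := L_bounds.
have c0 : 0 < c by rewrite /c divr_gt0 // subr_gt0.
apply/cvgrPdist_le => e e0.
have e40 : 0 < e / 4 by rewrite divr_gt0.
have [N0 _ HN] := tau_sum _ e40.
(* Once [x] and [log2 x] exceed [A], the error [c (x + log2 x)] is at most
   half of [e x log2 x]. *)
pose A := N0%:R + 4 * c / e + 1.
have P0 : 0 <= 4 * c / e.
  by apply: divr_ge0; [apply: mulr_ge0 => // |]; exact: ltW.
have N0ge := ler0n R N0.
have A1 : 1 <= A by rewrite /A; lra.
have AN : N0%:R <= A by rewrite /A; lra.
have Ac : 4 * c <= e * A.
  by rewrite [leRHS]mulrC -ler_pdivrMr // /A; lra.
near=> x.
have xA : A <= x by near: x; apply: nbhs_pinfty_ge; exact: num_real.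
have x2A : pow2 A <= x by near: x; apply: nbhs_pinfty_ge; exact: num_real.
have x1 : 1 <= x by exact: le_trans xA.
have x0 : 0 < x by exact: lt_le_trans x1.
set l := log2 x.
have lA : A <= l by rewrite -[leLHS]log2_pow2; apply: ler_log2 => //; rewrite pow2_gt0.
set K := Num.truncn x.
have /andP[K1 K2] : K%:R <= x < K.+1%:R by apply: truncn_itv; exact: ltW.
have K0 : (0 < K)%N by rewrite -ltnS -(ltr_nat R); exact: le_lt_trans x1 K2.
have /andP[T1 T2] := trunc_log_bounds (isT : (1 < 2)%N) K0.
set N := (trunc_log 2 K).+1 in T2.
have lN : l <= N%:R.
  rewrite -[leRHS]log2_pow2; apply: ler_log2 => //; rewrite pow2_nat.
  by apply: ltW (lt_le_trans K2 _); rewrite ler_nat.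
have Nl : N%:R <= l + 1.
  rewrite -natr1 lerD2r -[leLHS]log2_pow2; apply: ler_log2; rewrite ?pow2_gt0 //.
  by rewrite pow2_nat; apply: le_trans K1; rewrite ler_nat.
have := HN N _ K _ T2; rewrite expnS leq_mul2l T1 => /(_ _ isT) H.
have {}H : `|\sum_(1 <= m < K.+1) (tau m)%:R - c * N%:R * K%:R| <= e / 4 * N%:R * K%:R.
  apply: H => /=; rewrite -(ler_nat R); apply: (le_trans AN); exact: le_trans lN.
move: H; set S := \sum_(1 <= m < K.+1) _.
move: S => S H.
have xl0 : 0 < x * l by rewrite mulr_gt0 // (lt_le_trans _ lA) // (lt_le_trans _ A1).
rewrite -(ler_pM2r xl0).
have -> : `|c - 1 / (x * l) * S| * (x * l) = `|c * (x * l) - S|.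
  rewrite -[X in _ * X = _]gtr0_norm // -normrM; congr `|_|.
  by rewrite mulrBl; congr (_ - _); rewrite div1r mulrAC mulVf ?mul1r // gt_eqF.
have Kx : x < K%:R + 1 by rewrite natr1.
have up : N%:R * K%:R <= (l + 1) * x by rewrite ler_pM.
have lo : l * (x - 1) <= N%:R * K%:R by rewrite ler_pM //; lra.
have ex : 4 * c * l <= e * (x * l).
  rewrite [leRHS]mulrA ler_pM2r; [apply: le_trans Ac _; rewrite ler_pM2l // | lra].
have el : 4 * c * x <= e * (x * l).
  rewrite (mulrC x) [leRHS]mulrA ler_pM2r //; apply: le_trans Ac _; rewrite ler_pM2l //.
have xxl : x <= x * l by rewrite ler_peMr; lra.
have up4 := ler_wpM2l (ltW e40) up.
have upc := ler_wpM2l (ltW c0) up.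
have loc := ler_wpM2l (ltW c0) lo.
have exl := ler_wpM2l (ltW e40) xxl.
by move: H; rewrite !ler_norml => /andP[H1 H2]; apply/andP; split; lra.
Unshelve. all: by end_near. Qed.

End BoundedStopping.

End Density.

Local Open Scope classical_set_scope.
Local Open Scope ring_scope.

Theorem theorem1p8 (R : realType)
    (hlog : exists C : R, 0 < C /\ forall m : nat, (0 < m)%N ->
       (total_stopping_time R m <= (C * log2 (m%:R : R))%:E)%E) :
  ((1 / (x * log2 x))%:E *
     \sum_(1 <= m < (Num.truncn x).+1) total_stopping_time R m)%E
    @[x --> +oo%R] --> (1 / (1 - log2 (Num.sqrt 3)) : R)%:E.
Proof.
have [C [C0 hC]] := hlog.
pose reach m := exists n, iter n collatzT m == 1%N.
pose tau m := if pselect (reach m) is left h then ex_minn h else 0%N.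
have tauE m : (0 < m)%N -> total_stopping_time R m = (tau m)%:R%:E /\ reach m.
  move=> /hC; rewrite /total_stopping_time /tau.
  by case: pselect => // h _; case: pselect.
have tau_reach m : (0 < m)%N -> iter (tau m) collatzT m = 1%N.
  move=> /tauE[_ rm]; rewrite /tau; case: pselect => // h.
  by case: ex_minnP => n /eqP.
have tau_min m n : (0 < m)%N -> iter n collatzT m = 1%N -> (tau m <= n)%N.
  move=> /tauE[_ rm] it; rewrite /tau; case: pselect => // h.
  by case: ex_minnP => k _; apply; exact/eqP.
have tau_log m : (0 < m)%N -> (tau m)%:R <= C * log2 m%:R.
  by move=> m0; rewrite -lee_fin -(tauE m m0).1; exact: hC.
have avg := tau_average R C tau C0 tau_reach tau_min tau_log.
rewrite (_ : (fun x => _) = (fun x => (1 / (x * log2 x) *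
    \sum_(1 <= m < (Num.truncn x).+1) (tau m)%:R)%:E)).
  by apply: cvg_EFin avg; exact: nearW.
apply/funext => x; rewrite [RHS]EFinM -sumEFin; congr (_ * _)%E.
by apply: eq_big_nat => m /andP[m0 _]; rewrite (tauE m m0).1.
Qed.
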